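(* There does not exist a natural number $m \ge 1$ such that $$\mathcal{GD}^m(A) = \mathcal{GD}^{m+1}(A) = \mathcal{GD}^{m+2}(A) = \cdots$$ for every natural number $n \ge 1$ and every subanalytic set $A \subset \mathbb{R}^n$ with $0 \in \overline{A}$.
   Context: Subanalytic is in the sense of Hironaka; $\overline{\,\cdot\,}$ denotes closure. For $A \subset \mathbb{R}^n$ and $p \in \overline{A}$, the direction set of $A$ at $p$ is $$D_p(A) := \{a \in S^{n-1} \mid \exists \{x_i\} \subset A \setminus \{p\},\ x_i \to p,\ \tfrac{x_i-p}{\|x_i-p\|} \to a\}.$$ Put $D_A(A) := \bigcup_{p \in A} \{p\} \times D_p(A) \subset \mathbb{R}^n \times S^{n-1}$. The geometric directional bundle of $A$ at $0$ is $$\mathcal{GD}(A) := \{a \in S^{n-1} \mid (0,a) \in \overline{D_A(A)}\},$$ closure in $\mathbb{R}^n \times S^{n-1}$, and $L\mathcal{GD}(A) := \{tv \in \mathbb{R}^n \mid v \in \mathcal{GD}(A),\ t \ge 0\}$ (so $L\mathcal{GD}(A) = \emptyset$ if $\mathcal{GD}(A)=\emptyset$, and $\mathcal{GD}(\emptyset)=\emptyset$). Set $\mathcal{GD}^1 := \mathcal{GD}$ and, for $m \ge 2$, $\mathcal{GD}^m(A) := \mathcal{GD}(L\mathcal{GD}^{m-1}(A))$, where $L\mathcal{GD}^{m}(A) := \{tv \mid v \in \mathcal{GD}^{m}(A),\ t \ge 0\}$. *)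

(* Defs.v *)
From HB Require Import structures.
From mathcomp Require Import all_boot all_order all_algebra.
From mathcomp Require Import all_classical all_reals all_analysis.
Set Implicit Arguments.
Unset Strict Implicit.
Unset Printing Implicit Defensive.
Import Order.TTheory GRing.Theory Num.Theory.
Import numFieldNormedType.Exports.
Local Open Scope classical_set_scope.
Local Open Scope ring_scope.

(* The library's norm `|x| on 'rV[R]_n is the sup norm; directions need the
   Euclidean one. *)
Definition enorm (R : realType) (n : nat) (x : 'rV[R]_n) : R :=
  Num.sqrt (\sum_(i < n) x ord0 i ^+ 2).

Definition unit_sphere (R : realType) (n : nat) : set 'rV[R]_n :=
  [set a | enorm a = 1].

(* Real analyticity: around p, f is the sum of an absolutely convergent
   multi-index power series.  The multi-indices in {0, ..., k-1}^d exhaust all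
   multi-indices as k grows; under absolute convergence the order of summation
   is irrelevant. *)

Definition ps_term (R : realType) (d : nat) (c : ('I_d -> nat) -> R)
    (h : 'rV[R]_d) (a : 'I_d -> nat) : R :=
  c a * \prod_(i < d) h ord0 i ^+ a i.

Definition analytic_at (R : realType) (d : nat) (f : 'rV[R]_d -> R)
    (p : 'rV[R]_d) : Prop :=
  exists (c : ('I_d -> nat) -> R) (r : R), 0 < r /\
    forall h : 'rV[R]_d, (forall i, `|h ord0 i| < r) ->
      cvgn (fun k => \sum_(a : {ffun 'I_d -> 'I_k})
                       `|ps_term c h (fun i => a i : nat)|) /\
      (fun k => \sum_(a : {ffun 'I_d -> 'I_k})
                  ps_term c h (fun i => a i : nat)) @ \oo --> f (p + h).

Definition analytic_in (R : realType) (d n : nat) (W : set 'rV[R]_d)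
    (f : 'rV[R]_d -> 'rV[R]_n) : Prop :=
  forall p, W p -> forall j, analytic_at (fun x => f x ord0 j) p.

(* cmap and cinv are total functions; only their restrictions to cdom and to
   its image are meaningful. *)
Record chart (R : realType) (d : nat) (M : topologicalType) := Chart {
  cdom : set M;
  cmap : M -> 'rV[R]_d;
  cinv : 'rV[R]_d -> M;
  cdom_open : open cdom;
  cimg_open : open (cmap @` cdom);
  cmapK : {in cdom, cancel cmap cinv};
  cmap_continuous : {within cdom, continuous cmap};
  cinv_continuous : {within cmap @` cdom, continuous cinv} }.

(* Real analytic manifolds without boundary, of pure dimension d, Hausdorff and
   second countable, possibly empty, given by a (not necessarily maximal)
   analytic atlas. *)
Record analytic_manifold (R : realType) (d : nat) := AnalyticManifold {
  mfd_carrier :> topologicalType;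
  mfd_atlas : set (chart R d mfd_carrier);
  mfd_hausdorff : hausdorff_space mfd_carrier;
  mfd_second_countable : @second_countable mfd_carrier;
  mfd_cover : forall x : mfd_carrier, exists2 c, mfd_atlas c & cdom c x;
  mfd_transition : forall c1 c2, mfd_atlas c1 -> mfd_atlas c2 ->
    analytic_in (cmap c1 @` (cdom c1 `&` cdom c2)) (cmap c2 \o cinv c1) }.

Definition analytic_map (R : realType) (d n : nat) (Y : analytic_manifold R d)
    (f : Y -> 'rV[R]_n) : Prop :=
  forall c, mfd_atlas c -> analytic_in (cmap c @` cdom c) (f \o cinv c).

Definition proper_into (T X : topologicalType) (U : set X) (f : T -> X) : Prop :=
  range f `<=` U /\
  forall K : set X, K `<=` U -> compact K -> compact (f @^-1` K).

Definition proper_analytic_image (R : realType) (n : nat) (U B : set 'rV[R]_n)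
    : Prop :=
  exists (d : nat) (Y : analytic_manifold R d) (f : Y -> 'rV[R]_n),
    [/\ analytic_map f, proper_into U f & B = range f].

(* Hironaka: near every point p of the ambient space (not only points of A),
   A is a finite union of differences of images of proper analytic maps. *)
Definition subanalytic (R : realType) (n : nat) (A : set 'rV[R]_n) : Prop :=
  forall p : 'rV[R]_n, exists U : set 'rV[R]_n, open_nbhs p U /\
    exists (N : nat) (B C : 'I_N -> set 'rV[R]_n),
      (forall i, proper_analytic_image U (B i) /\
                 proper_analytic_image U (C i)) /\
      A `&` U = \bigcup_(i in [set: 'I_N]) (B i `\` C i).

Definition direction_set (R : realType) (n : nat) (A : set 'rV[R]_n)
    (p : 'rV[R]_n) : set 'rV[R]_n :=
  [set a | unit_sphere a /\
    exists x : nat -> 'rV[R]_n,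
      [/\ forall i, (A `\ p) (x i),
          x @ \oo --> p &
          (fun i => (enorm (x i - p))^-1 *: (x i - p)) @ \oo --> a]].

Definition direction_bundle (R : realType) (n : nat) (A : set 'rV[R]_n)
    : set ('rV[R]_n * 'rV[R]_n) :=
  [set q | A q.1 /\ direction_set A q.1 q.2].

(* The closure is taken in R^n x R^n; on R^n x S^(n-1), where a lives, it agrees
   with the closure in that subspace. *)
Definition GD (R : realType) (n : nat) (A : set 'rV[R]_n) : set 'rV[R]_n :=
  [set a | unit_sphere a /\ closure (direction_bundle A) (0, a)].

Definition half_cone (R : realType) (n : nat) (D : set 'rV[R]_n)
    : set 'rV[R]_n :=
  [set w | exists (t : R) (v : 'rV[R]_n), [/\ D v, 0 <= t & w = t *: v]].

(* GD^m(A) for m >= 1; the value at m = 0 is junk. *)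
Definition GDpow (R : realType) (n m : nat) (A : set 'rV[R]_n)
    : set 'rV[R]_n :=
  iter m.-1 (fun D => GD (half_cone D)) (GD A).

(* Main.v *)
Require Import Defs.
From mathcomp Require Import all_boot all_order all_algebra.
From mathcomp Require Import all_classical all_reals all_analysis.
From mathcomp Require Import zify ring lra.
Import Order.TTheory GRing.Theory Num.Theory.
Import numFieldNormedType.Exports.
Local Open Scope classical_set_scope.
Local Open Scope ring_scope.

(** The counterexamples are the cones [A = {x x^T}] of rank one squares in the
    space of [n x n] matrices, which are images of proper quadratic maps.
    A matrix in [GD K] is a limit of multiples of differences of matrices of [K],
    so [GD] at most doubles the maximal rank, and [GD^m A] consists of matrices of
    rank at most [2^m].  On the other hand, if [GD^m A = GD^(m+1) A], then the cone
    [C] over [GD^m A] contains the velocities of all curves in [C].  It contains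
    the [x x^T], hence their velocities [x y^T + y x^T], and the velocity of a
    curve of sums of [j] such terms is an arbitrary sum of [2 j] of them; so [C]
    contains the identity matrix, of rank [n], which is impossible for
    [n = 2^(m+1)]. *)

(** * Closedness of the set of matrices of bounded rank *)

(** If the rank exceeds [r], inverting the two bases of Gaussian elimination and truncating with
    [pid_mx] makes [P *m M *m Q] the identity of size [r.+1]. Using all [P] and [Q] in place of
    minors expresses the rank bound by the vanishing of continuous functions. *)
Lemma mxrank_le_det (F : fieldType) (m n r : nat) (M : 'M[F]_(m, n)) :
  (\rank M <= r)%N <->
  forall (P : 'M[F]_(r.+1, m)) (Q : 'M[F]_(n, r.+1)), \det (P *m M *m Q) = 0.
Proof.
split=> [rM P Q | detM].
  apply/eqP; rewrite -[_ == 0]negbK -unitfE -unitmxE -row_free_unit -row_leq_rank.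
  rewrite -ltnNge ltnS (leq_trans (mxrankM_maxl _ _))//.
  by rewrite (leq_trans (mxrankM_maxr _ _)).
rewrite leqNgt; apply/negP => rM.
have := detM (pid_mx r.+1 *m invmx (col_ebase M)) (invmx (row_ebase M) *m pid_mx r.+1).
set P := _ *m invmx _; set Q := invmx _ *m _.
have -> : P *m M *m Q = P *m (col_ebase M *m pid_mx (\rank M) *m row_ebase M) *m Q.
  by rewrite mulmx_ebase.
rewrite /P /Q !mulmxA mulmxKV ?col_ebase_unit// mulmxK ?row_ebase_unit//.
rewrite !mul_pid_mx.
have -> : minn n (minn (minn m (minn r.+1 (\rank M))) r.+1) = r.+1.
  have rm := rank_leq_row M; have rn := rank_leq_col M; lia.
by rewrite pid_mx_1 det1 => /eqP; rewrite oner_eq0.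
Qed.

Lemma continuous_sum {T : topologicalType} {R : realType} (I : Type) (r : seq I)
    (P : pred I) (f : I -> T -> R) :
  (forall i, continuous (f i)) ->
  continuous (fun x => \sum_(i <- r | P i) f i x).
Proof.
move=> cf x; elim: r => [|i r IHr].
  by under eq_fun do rewrite big_nil; exact: cvg_cst.
under eq_fun do rewrite big_cons.
by case: (P i) => //; apply: cvgD => //; exact: cf.
Qed.

Lemma continuous_prod {T : topologicalType} {R : realType} (I : Type) (r : seq I)
    (P : pred I) (f : I -> T -> R) :
  (forall i, continuous (f i)) ->
  continuous (fun x => \prod_(i <- r | P i) f i x).
Proof.
move=> cf x; elim: r => [|i r IHr].
  by under eq_fun do rewrite big_nil; exact: cvg_cst.
under eq_fun do rewrite big_cons.
by case: (P i) => //; apply: cvgM => //; exact: cf.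
Qed.

Lemma continuous_mx {T : topologicalType} {R : realType} (m n : nat)
    (f : T -> 'M[R]_(m, n)) :
  (forall i j, continuous (fun x => f x i j)) -> continuous f.
Proof.
move=> cf x; apply/cvg_ballP => e e0.
have: \forall y \near x, forall ij : 'I_m * 'I_n,
    ball (f x ij.1 ij.2) e (f y ij.1 ij.2).
  apply: filter_forall => -[i j] /=.
  by move/cvg_ballP : (cf i j x) => /(_ e e0).
by apply: filterS => y fy; split=> // i j; exact: (fy (i, j)).
Qed.

Lemma continuous_mulmx {T : topologicalType} {R : realType} (m n p : nat)
    (f : T -> 'M[R]_(m, n)) (g : T -> 'M[R]_(n, p)) :
  (forall i j, continuous (fun x => f x i j)) ->
  (forall i j, continuous (fun x => g x i j)) ->
  forall i j, continuous (fun x => (f x *m g x) i j).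
Proof.
move=> cf cg i j; under eq_fun do rewrite mxE.
by apply: continuous_sum => k x; exact: (cvgM (cf i k x) (cg k j x)).
Qed.

Lemma continuous_det {T : topologicalType} {R : realType} {n : nat}
    (f : T -> 'M[R]_n) :
  (forall i j, continuous (fun x => f x i j)) ->
  continuous (fun x => \det (f x)).
Proof.
move=> cf; apply: continuous_sum => s x.
by apply: cvgM; [exact: cvg_cst|apply: continuous_prod].
Qed.

Lemma continuous_enorm {R : realType} {n : nat} : continuous (@enorm R n).
Proof.
move=> x; apply: (@continuous_comp _ _ _
  (fun x : 'rV[R]_n => \sum_(i < n) x ord0 i ^+ 2) Num.sqrt).
  apply: continuous_sum => i y.
  have ci := @coord_continuous R 1 n ord0 i y; exact: (cvgM ci ci).
exact: sqrt_continuous.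
Qed.

Lemma closed_mxrank_le {R : realType} (m n r : nat) :
  closed [set a : 'rV[R]_(m * n) | (\rank (vec_mx a) <= r)%N].
Proof.
have -> : [set a : 'rV[R]_(m * n) | (\rank (vec_mx a) <= r)%N] =
    \bigcap_(PQ in [set: 'M[R]_(r.+1, m) * 'M[R]_(n, r.+1)])
      ((fun a => \det (PQ.1 *m vec_mx a *m PQ.2)) @^-1` [set 0]).
  apply/seteqP; split=> a /=.
    by move=> /mxrank_le_det ra [P Q] _; exact: ra.
  by move=> ra; apply/mxrank_le_det => P Q; exact: (ra (P, Q)).
apply: closed_bigI => -[P Q] _; apply: closed_comp; last exact: closed_eq.
suff cf : continuous (fun a : 'rV[R]_(m * n) => \det (P *m vec_mx a *m Q)).
  by move=> a _; exact: cf.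
apply: continuous_det => i j; apply: continuous_mulmx; last first.
  by move=> ? ?; exact: cst_continuous.
move=> {}i {}j; apply: continuous_mulmx.
  by move=> ? ?; exact: cst_continuous.
by move=> {}i {}j; under eq_fun do rewrite mxE; exact: coord_continuous.
Qed.

(** * Upper and lower bounds for the geometric directional bundle *)

(** Normalised chords have the form [t *: (x - y)]. Both limits, first to a direction and then to
    the closure of the bundle, stay in the closed set [E]. *)
Lemma GD_subset_closed {R : realType} {n : nat} (K E : set 'rV[R]_n) :
  closed E ->
  (forall x y (t : R), K x -> K y -> E (t *: (x - y))) -> GD K `<=` E.
Proof.
move=> cE KE a [_ aK]; apply: (cE) => B Ba.
have : nbhs (0 : 'rV[R]_n, a) (setT `*` B).
  by exists (setT, B) => //=; split=> //; exact: filterT.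
move=> /aK[[p b] /= [[Kp [_ [x [xK xp xb]]]] [_ Bb]]].
exists b; split=> //. apply: (closed_cvg E cE _ _ xb).
by apply: nearW => i; apply: KE => //; have [] := xK i.
Qed.

Lemma enorm_ge0 {R : realType} {n : nat} (x : 'rV[R]_n) : 0 <= enorm x.
Proof. exact: sqrtr_ge0. Qed.

Lemma enorm_gt0 {R : realType} {n : nat} {x : 'rV[R]_n} : x != 0 -> 0 < enorm x.
Proof.
rewrite /enorm sqrtr_gt0 lt_def sumr_ge0 ?andbT => [x0|i _]; last exact: sqr_ge0.
apply: contra x0; rewrite psumr_eq0 => [/allP x0|i _]; last exact: sqr_ge0.
apply/eqP/rowP => i; rewrite mxE; apply/eqP.
by have := x0 i (mem_index_enum _); rewrite sqrf_eq0.
Qed.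

Lemma enormZ {R : realType} {n : nat} (t : R) (x : 'rV[R]_n) :
  enorm (t *: x) = `|t| * enorm x.
Proof.
rewrite /enorm -sqrtr_sqr -sqrtrM ?sqr_ge0// mulr_sumr.
by congr Num.sqrt; apply: eq_bigr => i _; rewrite mxE exprMn.
Qed.

(* A velocity [v] of a curve in a cone [K] at [p] is also one at [t *: p], so
   it is a limit direction at points arbitrarily close to the vertex. *)
Lemma half_cone_GD_velocity {R : realType} {n : nat} (K : set 'rV[R]_n)
    (p v w : 'rV[R]_n) :
  (forall (t : R) x, 0 < t -> K x -> K (t *: x)) ->
  K p -> (forall s : R, 0 < s -> K (p + s *: v + s ^+ 2 *: w)) ->
  v != 0 -> half_cone (GD K) v.
Proof.
move=> coneK Kp Kc v0.
have ev := enorm_gt0 v0.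
exists (enorm v), ((enorm v)^-1 *: v); split; [|exact: enorm_ge0|]; last first.
  by rewrite scalerA mulfV ?scale1r// gt_eqF.
pose a := (enorm v)^-1 *: v.
have ea : unit_sphere a.
  by rewrite /unit_sphere/= enormZ gtr0_norm ?invr_gt0// mulVf// gt_eqF.
split=> //.
(* For [s <= e] the term [s *: w] is shorter than [v], so the curve really leaves [p] and its chords
   can be normalised. *)
have [e e0 eP] : exists2 e : R, 0 < e & forall s, 0 < s -> s <= e -> v + s *: w != 0.
  have nv : 0 < `|v| by rewrite normr_gt0.
  have nw : 0 < `|w| + 1 by rewrite ltr_wpDl.
  exists (`|v| / (2 * (`|w| + 1))); first by rewrite divr_gt0// mulr_gt0.
  move=> s s0; rewrite ler_pdivlMr ?mulr_gt0// => se.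
  apply/negP; rewrite addr_eq0 => /eqP vE.
  have : `|v| = s * `|w| by rewrite vE normrN normrZ gtr0_norm.
  have := normr_ge0 w; nra.
have e_i (i : nat) : 0 < e * i.+1%:R^-1 by rewrite mulr_gt0// invr_gt0.
have ve_i (i : nat) : v + (e * i.+1%:R^-1) *: w != 0.
  by apply: eP => //; apply: ler_piMr; [exact: ltW|rewrite invf_le1// ler1n].
(* Scaling the curve by [t] moves its base point to [t *: p] and multiplies each chord by [t], which
   leaves the normalised chords unchanged. *)
have dir (t : R) : 0 < t -> direction_bundle K (t *: p, a).
  move=> t0; split=> /=; first exact: coneK.
  split=> //; pose s (i : nat) := e * i.+1%:R^-1.
  have s0 : s i @[i --> \oo] --> (0 : R).
    rewrite -[X in _ --> X](mulr0 e); apply: cvgMr; exact: cvg_harmonic.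
  have vs : v + s i *: w @[i --> \oo] --> v.
    rewrite -[X in _ --> X]addr0; apply: cvgD; first exact: cvg_cst.
    by rewrite -[X in _ --> X](scale0r w); apply: cvgZr_tmp.
  exists (fun i => t *: p + (t * s i) *: (v + s i *: w)).
  have dE i : t *: p + (t * s i) *: (v + s i *: w) - t *: p =
      (t * s i) *: (v + s i *: w) by rewrite addrC addKr.
  split.
  - move=> i; split.
      have := coneK t _ t0 (Kc (s i) (e_i i)).
      by rewrite !scalerDr !scalerA expr2 mulrA addrA.
    move=> /= /eqP; rewrite -subr_eq0 dE scaler_eq0 mulf_eq0.
    by rewrite (gt_eqF t0) (gt_eqF (e_i i)) (negPf (ve_i i)).
  - rewrite -[X in _ --> X]addr0; apply: cvgD; first exact: cvg_cst.
    rewrite -[X in _ --> X](scale0r v); apply: cvgZ => //.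
    by rewrite -[X in _ --> X](mulr0 t); apply: cvgMr.
  - have -> : (fun i => (enorm (t *: p + (t * s i) *: (v + s i *: w) - t *: p))^-1 *:
        (t *: p + (t * s i) *: (v + s i *: w) - t *: p)) =
        (fun i => (enorm (v + s i *: w))^-1 *: (v + s i *: w)).
      apply/funext => i; rewrite dE enormZ gtr0_norm ?mulr_gt0 ?e_i//.
      rewrite scalerA invfM mulrAC mulVf ?mul1r//.
      by rewrite gt_eqF// mulr_gt0// e_i.
    apply: cvgZ => //; apply: cvgV; first by rewrite gt_eqF.
    exact: (cvg_comp _ _ vs (continuous_enorm v)).
move=> B [[B1 B2] /= [B10 B2a] B12].
(* The base points now tend to the vertex while the direction [a] stays fixed. *)
have t0 : harmonic i *: p @[i --> \oo] --> (0 : 'rV[R]_n).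
  rewrite -[X in _ --> X](scale0r p); apply: cvgZr_tmp; exact: cvg_harmonic.
have [i _ /(_ i (leqnn i)) /= B1i] := t0 _ B10.
exists (harmonic i *: p, a); split; first by apply: dir; exact: harmonic_gt0.
by apply: B12; split=> //; exact: nbhs_singleton.
Qed.

(** * Ranks and velocities in the cones over the iterated bundles *)

Definition square_map {R : realType} (n : nat) (x : 'rV[R]_n) : 'rV[R]_(n * n) :=
  mxvec (x^T *m x).

Lemma GDpowSS {R : realType} {n : nat} (k : nat) (A : set 'rV[R]_n) :
  GDpow k.+2 A = GD (half_cone (GDpow k.+1 A)).
Proof. by []. Qed.

Lemma half_coneZ {R : realType} {n : nat} (D : set 'rV[R]_n) (t : R)
    (x : 'rV[R]_n) :
  0 < t -> half_cone D x -> half_cone D (t *: x).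
Proof.
move=> t0 [s [v [Dv s0 ->]]]; exists (t * s), v.
by rewrite scalerA mulr_ge0// ltW.
Qed.

Lemma half_cone0 {R : realType} {n : nat} (D : set 'rV[R]_n) (x : 'rV[R]_n) :
  half_cone D x -> half_cone D 0.
Proof. by move=> [s [v [Dv _ _]]]; exists 0, v; rewrite scale0r. Qed.

Lemma mxrank_half_cone {R : realType} (m n r : nat) (D : set 'rV[R]_(m * n)) :
  (forall a, D a -> \rank (vec_mx a) <= r)%N ->
  forall a, half_cone D a -> (\rank (vec_mx a) <= r)%N.
Proof.
by move=> Dr _ [t [v [/Dr vr _ ->]]]; rewrite linearZ (leq_trans (mxrank_scale _ _)).
Qed.

Lemma mxrank_GD {R : realType} (m n r : nat) (K : set 'rV[R]_(m * n)) :
  (forall a, K a -> \rank (vec_mx a) <= r)%N ->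
  forall a, GD K a -> (\rank (vec_mx a) <= r + r)%N.
Proof.
move=> Kr; apply: GD_subset_closed; first exact: closed_mxrank_le.
move=> x y t /Kr xr /Kr yr /=.
rewrite linearZ linearB/= (leq_trans (mxrank_scale _ _))//.
by rewrite (leq_trans (mxrank_add _ _))// mxrank_opp leq_add.
Qed.

Lemma mxrank_GDpow {R : realType} (n k : nat) (a : 'rV[R]_(n * n)) :
  GDpow k.+1 (range (square_map n)) a -> (\rank (vec_mx a) <= 2 ^ k.+1)%N.
Proof.
elim: k a => [|k IHk] a.
  apply: (@mxrank_GD R n n 1) => _ [x _ <-].
  by rewrite mxvecK (leq_trans (mxrankM_maxr _ _)) ?rank_leq_row.
by rewrite GDpowSS expnSr muln2 -addnn; apply: mxrank_GD; exact: mxrank_half_cone.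
Qed.

(** The ray [s *: v] issuing from the vertex has velocity [v]. *)
Lemma half_cone_GD_mem {R : realType} {n : nat} (K : set 'rV[R]_n)
    (v : 'rV[R]_n) :
  (forall (t : R) x, 0 < t -> K x -> K (t *: x)) ->
  K 0 -> K v -> v != 0 -> half_cone (GD K) v.
Proof.
move=> coneK K0 Kv; apply: (@half_cone_GD_velocity _ _ K 0 v 0) => // s s0.
by rewrite add0r scaler0 addr0; exact: coneK.
Qed.

Lemma square_mapZ {R : realType} (n : nat) (t : R) (x : 'rV[R]_n) :
  square_map n (t *: x) = t ^+ 2 *: square_map n x.
Proof.
by rewrite /square_map [(t *: x)^T]linearZ/= -scalemxAr -scalemxAl scalerA -expr2 linearZ.
Qed.

Lemma half_cone_GDpow_square {R : realType} (n k : nat) (x : 'rV[R]_n.+1) :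
  half_cone (GDpow k.+1 (range (square_map n.+1))) (square_map n.+1 x).
Proof.
set A := range _.
have coneA (t : R) y : 0 < t -> A y -> A (t *: y).
  move=> t0 [z _ <-]; exists (Num.sqrt t *: z) => //.
  by rewrite square_mapZ sqr_sqrtr// ltW.
have A0 : A 0.
  by exists 0 => //; rewrite /square_map mulmx0 linear0.
have nz (y : 'rV[R]_(n.+1 * n.+1)) : A y -> y != 0 ->
    half_cone (GDpow k.+1 A) y.
  elim: k y => [|k IHk] y Ay y0; first exact: half_cone_GD_mem.
  have yC := IHk _ Ay y0; apply: half_cone_GD_mem => //.
  - by move=> t z; exact: half_coneZ.
  - exact: half_cone0 yC.
(* The zero square is reached as the vertex, which is present once the cone is nonempty; the
   all-ones vector supplies a nonzero square because the dimension is positive. *)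
have [->|x0] := eqVneq (square_map n.+1 x) 0; last by apply: nz => //; exists x.
apply: (@half_cone0 _ _ _ (square_map n.+1 (const_mx 1))).
apply: nz; first by exists (const_mx 1).
apply/negP => /eqP /(congr1 vec_mx); rewrite mxvecK linear0.
move=> /matrixP /(_ ord0 ord0); rewrite !mxE big_ord1 !mxE mulr1 => /eqP.
by rewrite oner_eq0.
Qed.

(** Since [D] is fixed, the cone over [GD (half_cone D)] in which velocities lie is the original
    cone. A zero velocity is the vertex of that cone, which is nonempty by [p]. *)
Lemma stable_velocity {R : realType} {n : nat} (D : set 'rV[R]_(n * n))
    (p v w : 'M[R]_n) :
  GD (half_cone D) = D ->
  half_cone D (mxvec p) ->
  (forall s : R, half_cone D (mxvec (p + s *: v + s ^+ 2 *: w))) ->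
  half_cone D (mxvec v).
Proof.
move=> stableD Dp Dc; have [->|v0] := eqVneq (mxvec v) 0; first exact: half_cone0 Dp.
rewrite -stableD; apply: (@half_cone_GD_velocity _ _ _ (mxvec p) _ (mxvec w)) => //.
  by move=> t x; exact: half_coneZ.
by move=> s _; have := Dc s; rewrite !linearD !linearZ.
Qed.

(** Induction on [k]: each passage to velocities doubles the number of columns. The width [j] is a
    separate variable so that it can be a successor equal to [2 ^ k] only propositionally. *)
Lemma stable_sym_product {R : realType} {n : nat} (D : set 'rV[R]_(n * n))
    (k j : nat) (X Y : 'M[R]_(n, j)) :
  GD (half_cone D) = D ->
  (forall x : 'rV[R]_n, half_cone D (square_map n x)) ->
  j = (2 ^ k)%N ->
  half_cone D (mxvec (X *m Y^T + Y *m X^T)).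
Proof.
move=> stableD squareD; elim: k j X Y => [|k IHk] j X Y jE.
  move: X Y; rewrite {}jE => X Y.
  have sq (x : 'M[R]_(n, 1)) : half_cone D (mxvec (x *m x^T)).
    by have := squareD x^T; rewrite /square_map trmxK.
  (* The curve is the square of the moving column [X + s *: Y]. *)
  apply: (@stable_velocity _ _ D (X *m X^T) _ (Y *m Y^T)) => // s.
  have := sq (X + s *: Y); congr (half_cone D (mxvec _)).
  rewrite linearD linearZ/= !(mulmxDl, mulmxDr) -!scalemxAl -!scalemxAr scalerA.
  by rewrite scalerDr expr2 !addrA.
move: X Y; rewrite {}jE expnS mul2n -addnn => X Y.
(* The halves are paired crosswise: in the symmetrised product of [xr + s *: xl] and [yl + s *: yr],
   the coefficient of [s] collects left with left and right with right, which is the full product of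
   [X] and [Y]. *)
pose xl := lsubmx X; pose xr := rsubmx X; pose yl := lsubmx Y; pose yr := rsubmx Y.
apply: (@stable_velocity _ _ D (xr *m yl^T + yl *m xr^T) _ (xl *m yr^T + yr *m xl^T)) => //.
  exact: IHk.
move=> s; have := IHk _ (xr + s *: xl) (yl + s *: yr) erefl.
congr (half_cone D (mxvec _)).
rewrite -(hsubmxK X) -(hsubmxK Y) !tr_row_mx !mul_row_col -/xl -/xr -/yl -/yr.
rewrite ![(_ + _)^T]linearD/= ![(s *: _)^T]linearZ/=.
rewrite !(mulmxDl, mulmxDr, scalerDr) -!scalemxAl -!scalemxAr !scalerA -expr2.
apply/matrixP => a b; rewrite !mxE; ring.
Qed.

(** * Analytic monomials and Euclidean space as an analytic manifold *)

(** The power series at [p] is the product of the binomial expansions of the factors. Binomial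
    coefficients vanish beyond [e i], so the truncated subtraction is harmless and the partial sums
    are eventually constant. *)
Lemma analytic_monomial {R : realType} {d : nat} (b : R) (e : 'I_d -> nat)
    (p : 'rV[R]_d) :
  analytic_at (fun x => b * \prod_(i < d) x ord0 i ^+ e i) p.
Proof.
exists (fun a => b * \prod_(i < d) (p ord0 i ^+ (e i - a i) *+ 'C(e i, a i))), 1.
split=> // h _.
pose F i j : R := p ord0 i ^+ (e i - j) * h ord0 i ^+ j *+ 'C(e i, j).
have termE a : ps_term (fun a => b * \prod_(i < d)
    (p ord0 i ^+ (e i - a i) *+ 'C(e i, a i))) h a = b * \prod_(i < d) F i (a i).
  rewrite /ps_term -mulrA -big_split; congr (_ * _).
  by apply: eq_bigr => i _; rewrite /= mulrnAl.
(* Once [k] exceeds every exponent, the sum over multi-indices factors by distributivity. This is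
   used for the terms and for their absolute values. *)
have trunc (G : 'I_d -> nat -> R) : (forall i j, (e i < j)%N -> G i j = 0) ->
    \forall k \near \oo,
      \sum_(a : {ffun 'I_d -> 'I_k}) \prod_(i < d) G i (a i) =
      \prod_(i < d) \sum_(j < (e i).+1) G i j.
  move=> G0; have : \forall k \near \oo, forall i, (e i < k)%N.
    by apply: filter_forall => i; exact: nbhs_infty_gt.
  apply: filterS => k ek; rewrite -(bigA_distr_bigA (fun i (j : 'I_k) => G i j)).
  apply: eq_bigr => i _; rewrite (big_ord_widen _ _ (ek i)) [RHS]big_mkcond/=.
  by apply: eq_bigr => j _; case: ltnP => // /G0.
split.
  apply: (@is_cvg_near_cst _ _
    (`|b| * \prod_(i < d) \sum_(j < (e i).+1) `|F i j|)).
  apply: filterS (trunc (fun i j => `|F i j|) _) => [k <-|i j ij].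
    by rewrite mulr_sumr; apply: eq_bigr => a _; rewrite termE normrM normr_prod.
  by rewrite /F bin_small// mulr0n normr0.
apply: cvg_near_cst.
apply: filterS (trunc F _) => [k Fk|i j ij]; last by rewrite /F bin_small.
transitivity (b * \sum_(a : {ffun 'I_d -> 'I_k}) \prod_(i < d) F i (a i)).
  by rewrite mulr_sumr; apply: eq_bigr => a _; rewrite termE.
rewrite Fk; congr (_ * _); apply: eq_bigr => i _.
by rewrite mxE exprDn.
Qed.

(** The basis consists of the balls with rational centres and radii [k.+1%:R^-1]. *)
Lemma second_countable_rV {R : realType} (d : nat) :
  @second_countable 'rV[R]_d.
Proof.
pose q (u : 'rV[rat]_d) : 'rV[R]_d := map_mx ratr u.
pose B (uk : 'rV[rat]_d * nat) := ball (q uk.1) (uk.2.+1%:R^-1 : R).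
have k0 k : 0 < k.+1%:R^-1 :> R by rewrite invr_gt0.
exists (range B).
  have : countable [set: 'rV[rat]_d * nat] by exact: countableP.
  by apply: sub_countable; exact: card_image_le.
split=> [_ [uk _ <-]|x V /nbhs_ballP[e e0 eV]]; first exact: ball_open.
have [k ke] : exists k, k.+1%:R^-1 < e / 2 :> R.
  have [k] := ltr_add_invr (y := 0 : R) (x := e / 2) (divr_gt0 e0 (ltr0Sn _ 1)).
  by rewrite add0r => ke; exists k.
have /choice[r rP] : forall i, exists y : rat,
    ratr y \in `](x ord0 i), (x ord0 i + k.+1%:R^-1)[.
  by move=> i; apply: rat_in_itvoo; rewrite ltrDl.
have xr : ball (q (\row_i r i)) k.+1%:R^-1 x.
  split=> // i j; rewrite !mxE ord1; apply/ball_sym.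
  have := rP j; rewrite in_itv/= /ball/= => /andP[xj jx].
  by rewrite distrC gtr0_norm ?subr_gt0// ltrBlDl.
exists (B (\row_i r i, k)); first by split; first exists (\row_i r i, k).
apply: subset_trans eV => z zr.
rewrite (splitr e); apply: (@ball_triangle _ _ (q (\row_i r i))).
  by apply: ball_sym; apply: le_ball xr; exact: ltW.
by apply: le_ball zr; exact: ltW.
Qed.

Lemma open_image_id {T : topologicalType} : open (id @` [set: T]).
Proof. by rewrite image_id; exact: openT. Qed.

Lemma within_id_continuous {T : topologicalType} (A : set T) :
  {within A, continuous id}.
Proof. by apply: continuous_subspaceT => x. Qed.

Definition id_chart (R : realType) (d : nat) : chart R d 'rV[R]_d :=
  @Chart R d 'rV[R]_d setT id id openT open_image_id (fun x _ => erefl)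
    (@within_id_continuous _ _) (@within_id_continuous _ _).

Lemma analytic_coord {R : realType} {d : nat} (j : 'I_d) (p : 'rV[R]_d) :
  analytic_at (fun x => x ord0 j) p.
Proof.
have -> : (fun x : 'rV[R]_d => x ord0 j) =
    (fun x => 1 * \prod_(i < d) x ord0 i ^+ (i == j)).
  apply/funext => x; rewrite mul1r (bigD1 j)//= eqxx expr1 big1 ?mulr1// => i ij.
  by rewrite (negPf ij).
exact: analytic_monomial.
Qed.

Lemma id_chart_transition {R : realType} {d : nat} (c1 c2 : chart R d 'rV[R]_d) :
  [set id_chart R d] c1 -> [set id_chart R d] c2 ->
  analytic_in (cmap c1 @` (cdom c1 `&` cdom c2)) (cmap c2 \o cinv c1).
Proof. by move=> -> -> p _ j; exact: analytic_coord. Qed.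

Definition euclidean_manifold (R : realType) (d : nat) : analytic_manifold R d :=
  @AnalyticManifold R d 'rV[R]_d [set id_chart R d] (@norm_hausdorff _ _)
    (second_countable_rV d) (fun x => ex_intro2 _ _ (id_chart R d) erefl I)
    (@id_chart_transition R d).

(** * Subanalyticity of the cone of rank one squares *)

Lemma proper_analytic_image_rV {R : realType} (d n : nat)
    (f : 'rV[R]_d -> 'rV[R]_n) :
  (forall j p, analytic_at (fun x => f x ord0 j) p) ->
  (forall K : set 'rV[R]_n, compact K -> compact (f @^-1` K)) ->
  proper_analytic_image setT (range f).
Proof.
move=> fan fpr; exists d, (euclidean_manifold R d), f; split=> //.
  by move=> c -> p _ j; exact: fan.
by split=> // K _; exact: fpr.
Qed.

(** The source is the one-point space ['rV_0], whose compactness makes the constant map proper. *)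
Lemma proper_analytic_image_set1 {R : realType} (n : nat) (q : 'rV[R]_n) :
  proper_analytic_image setT [set q].
Proof.
have -> : [set q] = range (fun _ : 'rV[R]_0 => q).
  by apply/seteqP; split=> [_ ->|_ [x _ <-]//]; exists (0 : 'rV[R]_0).
apply: proper_analytic_image_rV => [j p|K _].
  have := analytic_monomial (q ord0 j) (fun=> 0) p.
  congr (analytic_at _ p); apply/funext => x.
  by rewrite big1 ?mulr1// => i; rewrite expr0.
have cT : compact [set: 'rV[R]_0].
  have -> : [set: 'rV[R]_0] = [set 0] by apply/seteqP; split=> // x _; exact: thinmx0.
  exact: compact_set1.
have [Kq|Kq] := pselect (K q).
  by rewrite (_ : _ @^-1` _ = setT)//; apply/seteqP; split.
by rewrite (_ : _ @^-1` _ = set0); [exact: compact0|apply/seteqP; split].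
Qed.

Lemma square_mapE {R : realType} (n : nat) (x : 'rV[R]_n) (i j : 'I_n) :
  square_map n x ord0 (mxvec_index i j) = x ord0 i * x ord0 j.
Proof. by rewrite mxvecE !mxE big_ord1 mxE. Qed.

Lemma analytic_square_map {R : realType} (n : nat) (k : 'I_(n * n))
    (p : 'rV[R]_n) :
  analytic_at (fun x => square_map n x ord0 k) p.
Proof.
case/mxvec_indexP: k => i j.
(* Adding the two indicators gives exponent 2 on the diagonal [i = j] without a case split. *)
have := analytic_monomial 1 (fun l => (l == i) + (l == j))%N p.
congr (analytic_at _ p); apply/funext => x.
rewrite square_mapE mul1r; under eq_bigr do rewrite exprD.
rewrite big_split/=; congr (_ * _).
  by rewrite (bigD1 i)//= eqxx expr1 big1 ?mulr1// => l /negPf ->.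
by rewrite (bigD1 j)//= eqxx expr1 big1 ?mulr1// => l /negPf ->.
Qed.

Lemma continuous_square_map {R : realType} (n : nat) :
  continuous (@square_map R n).
Proof.
apply: continuous_mx => i k; rewrite (ord1 i); case/mxvec_indexP: k => {}i j.
under eq_fun do rewrite square_mapE.
move=> x; exact: (cvgM (@coord_continuous R 1 n ord0 i x)
  (@coord_continuous R 1 n ord0 j x)).
Qed.

Lemma mx_entry_le_norm {R : realType} (m n : nat) (M : 'M[R]_(m, n))
    (i : 'I_m) (j : 'I_n) :
  `|M i j| <= `|M|.
Proof.
rewrite [leRHS]/Num.norm/= mx_normrE.
exact: (le_bigmax _ (fun ij : 'I_m * 'I_n => `|M ij.1 ij.2|) (i, j)).
Qed.

Lemma compact_preimage_square_map {R : realType} (n : nat)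
    (K : set 'rV[R]_(n * n)) :
  compact K -> compact (square_map n @^-1` K).
Proof.
move=> cK; have [M [_ KM]] := compact_bounded cK.
(* The added 1 meets the strict inequality in [compact_bounded] and makes the bound at least 1, so a
   bound on the diagonal entries, the squares of coordinates, also bounds the coordinates. *)
have {KM} KM x : K x -> `|x| <= `|M| + 1.
  by apply: KM; rewrite (le_lt_trans (ler_norm M))// ltrDl.
apply: (@subclosed_compact _ _
    [set v : 'rV[R]_n | forall i, `[- (`|M| + 1), `|M| + 1]%classic (v ord0 i)]).
- apply: closed_comp; last by apply: compact_closed => //; exact: norm_hausdorff.
  by move=> x _; exact: continuous_square_map.
- by apply: (@rV_compact _ _ (fun=> `[- (`|M| + 1), `|M| + 1]%classic)) => _;
  exact: segment_compact.
move=> x /= /KM xM i; rewrite in_itv/= -ler_norml.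
have : `|x ord0 i * x ord0 i| <= `|M| + 1.
  by apply: le_trans xM; rewrite -square_mapE; exact: mx_entry_le_norm.
have := normr_ge0 M; rewrite normrM; have := normr_ge0 (x ord0 i); nra.
Qed.

Lemma subanalytic_square_map {R : realType} (n : nat) :
  subanalytic (range (@square_map R n.+1)).
Proof.
move=> p; exists setT; split; first by split=> //; exact: openT.
(* A point off the image is subtracted, which avoids the empty manifold. *)
exists 1%N, (fun=> range (square_map n.+1)), (fun=> [set mxvec (- 1%:M)]); split.
  move=> _; split; last exact: proper_analytic_image_set1.
  apply: proper_analytic_image_rV; last exact: compact_preimage_square_map.
  exact: analytic_square_map.
rewrite setIT bigcup_const; last by exists ord0.
rewrite setDidl//; apply/seteqP; split=> // _ [[x _ <-]] /= xE.
(* The top left entry of an image point is a square, that of [- 1%:M] is -1. *)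
have := congr1 (fun M : 'rV[R]_(n.+1 * n.+1) => M ord0 (mxvec_index ord0 ord0)) xE.
rewrite square_mapE mxvecE !mxE /= => x2.
have := sqr_ge0 (x ord0 ord0); rewrite expr2 x2; lra.
Qed.

Theorem mainTheorem2 (R : realType) :
  ~ exists m : nat, (1 <= m)%N /\
      forall (n : nat) (A : set 'rV[R]_n),
        (1 <= n)%N -> subanalytic A -> closure A 0 ->
        forall k : nat, (m <= k)%N -> GDpow k A = GDpow k.+1 A.
Proof.
move=> [[|k] []] // _ stab.
(* With [m = k.+1], the matrix size [n.+1] is twice the rank bound [2 ^ k.+1] for [GDpow k.+1 A]. *)
pose n := (2 ^ k.+2).-1.
have nE : n.+1 = (2 ^ k.+2)%N by rewrite prednK// expn_gt0.
pose A : set 'rV[R]_(n.+1 * n.+1) := range (square_map n.+1).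
have A0 : closure A 0.
  by apply: subset_closure; exists 0 => //; rewrite /square_map mulmx0 linear0.
have := stab _ A isT (subanalytic_square_map n) A0 k.+1 (leqnn _).
rewrite GDpowSS => /esym stableD.
(* Half the identity paired with the identity symmetrises to the identity, whose full rank
   contradicts the bound. *)
have := @stable_sym_product R n.+1 _ k.+2 n.+1 (2^-1)%:M 1%:M stableD
  (half_cone_GDpow_square n k) nE.
have half : 2^-1 + 2^-1 = 1 :> R by lra.
rewrite !tr_scalar_mx mulmx1 mul1mx -raddfD /= half => /mxrank_half_cone.
move=> /(_ _ (@mxrank_GDpow R n.+1 k)); rewrite mxvecK mxrank1 nE.
by rewrite leq_exp2l// ltnn.
Qed.
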